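(* Let $A_1,\ldots,A_m$ be real $n\times n$ matrices. If the switched linear system $$x_{k+1}\in \mathrm{conv}\{A_1x_k,\ldots,A_mx_k\}$$ is asymptotically stable under arbitrary switching, then there exists a convex positive definite homogeneous polynomial $p:\mathbb{R}^n\to\mathbb{R}$ that satisfies $p(A_ix)<p(x)$ for all $x\neq 0$ and all $i\in\{1,\ldots,m\}$.
   Context: $\mathrm{conv}$ denotes the convex hull. A trajectory of the switched linear system is any sequence $(x_k)_{k\ge 0}$ in $\mathbb{R}^n$ with $x_{k+1}\in \mathrm{conv}\{A_1x_k,\ldots,A_mx_k\}$ for all $k$. The system is asymptotically stable under arbitrary switching if the origin is stable in the sense of Lyapunov (for every $\epsilon>0$ there is $\delta>0$ such that every trajectory with $\|x_0\|\le\delta$ satisfies $\|x_k\|\le\epsilon$ for all $k$) and every trajectory converges to the origin. Equivalently, the joint spectral radius $\rho(\mathcal{M})=\lim_{k\to\infty}\max_{M_1,\ldots,M_k\in\mathcal{M}}\|M_1\cdots M_k\|^{1/k}$ of $\mathcal{M}=\{A_1,\ldots,A_m\}$ is strictly less than one. A homogeneous polynomial $p$ is positive definite if $p(x)>0$ for all $x\neq 0$. *)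

(* Defs.v *)
From HB Require Import structures.
From mathcomp Require Import all_boot all_order all_algebra.
From mathcomp Require Import all_classical all_reals all_analysis.
(* The notations of mpoly clash with those of mathcomp-analysis. *)
From mathcomp Require Import -(notations) mpoly.

Set Implicit Arguments.
Unset Strict Implicit.
Unset Printing Implicit Defensive.

Import Order.TTheory GRing.Theory Num.Theory.
Import numFieldNormedType.Exports.

Local Open Scope classical_set_scope.
Local Open Scope ring_scope.

Definition convex_hull (R : numDomainType) (E : lmodType R) (S : set E) :
  set E := smallest (@convex_set R E) S.

Definition trajectory (R : realType) (m n : nat) (A : 'I_m -> 'M[R]_n)
    (x : nat -> 'cV[R]_n) : Prop :=
  forall k, convex_hull (range (fun i => A i *m x k)) (x k.+1).

(* The norm on 'cV[R]_n is the sup norm; since all norms on R^n are equivalent,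
   the notion below does not depend on this choice. *)
Definition lyapunov_stable (R : realType) (m n : nat)
    (A : 'I_m -> 'M[R]_n) : Prop :=
  forall eps : R, 0 < eps -> exists2 delta : R, 0 < delta &
    forall x, trajectory A x -> `|x 0%N| <= delta ->
      forall k, `|x k| <= eps.

Definition asymptotically_stable (R : realType) (m n : nat)
    (A : 'I_m -> 'M[R]_n) : Prop :=
  lyapunov_stable A /\
  forall x, trajectory A x -> x @ \oo --> (0 : 'cV[R]_n).

Definition mpoly_fun (R : realType) (n : nat) (p : mpoly.mpoly n R)
    (x : 'cV[R]_n) : R :=
  mpoly.meval (fun i => x i ord0) p.

Definition homogeneous (R : realType) (n : nat) (p : mpoly.mpoly n R) : Prop :=
  p \is @mpoly.ishomog n R mpoly.mdeg.

Definition convex_mpoly (R : realType) (n : nat) (p : mpoly.mpoly n R) : Prop :=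
  @convex_function R 'cV[R]_n setT (mpoly_fun p).

Definition positive_definite (R : realType) (n : nat)
    (p : mpoly.mpoly n R) : Prop :=
  forall x : 'cV[R]_n, x != 0 -> 0 < mpoly_fun p x.

(* Main.v *)
(** The [N]-fold products of the [A_i] eventually contract the sup norm by a
    factor 1/2: otherwise Koenig's lemma produces a trajectory staying away from
    the origin.  Let [q x = \sum_j x_j ^ e] with [e] even and let
    [(T f) x = \sum_i f (A_i x)].  Then [p = \sum_(k < N) T^k q] satisfies
    [p (A_i x) <= (T p) x = p x - q x + (T^N q) x], and
    [T^N q <= m^N n 2^-e q < q] once [e] is large.  All terms of [p] are even
    powers of linear forms, so [p] is convex and homogeneous. *)
Require Import Defs.
From mathcomp Require Import all_boot all_order all_algebra.
From mathcomp Require Import all_classical all_reals all_analysis.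
From mathcomp Require mpoly.
From mathcomp Require Import -(notations) mpoly.
From mathcomp Require Import ring lra.
Import Order.TTheory GRing.Theory Num.Theory.
Import numFieldNormedType.Exports.
Local Open Scope classical_set_scope.
Local Open Scope ring_scope.

Definition run {R : realType} {m n : nat} (A : 'I_m -> 'M[R]_n)
    (w : seq 'I_m) (x : 'cV[R]_n) : 'cV[R]_n :=
  foldl (fun y i => A i *m y) x w.

Lemma run_sum {R : realType} {m n : nat} (A : 'I_m -> 'M[R]_n) w
    (c : 'I_n -> R) (x : 'I_n -> 'cV[R]_n) :
  run A w (\sum_j c j *: x j) = \sum_j c j *: run A w (x j).
Proof.
elim: w x => //= i w IH x; rewrite mulmx_sumr -IH.
by congr (run A w _); apply: eq_bigr => j _; rewrite -scalemxAr.
Qed.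

Lemma runZ {R : realType} {m n : nat} (A : 'I_m -> 'M[R]_n) w (c : R) x :
  run A w (c *: x) = c *: run A w x.
Proof. by elim: w x => //= i w IH x; rewrite -scalemxAr. Qed.

Lemma hull_vertex {R : realType} {m n : nat} (A : 'I_m -> 'M[R]_n)
    (x : 'cV[R]_n) i :
  convex_hull (range (fun i => A i *m x)) (A i *m x).
Proof. by apply: sub_gen_smallest; exists i. Qed.

(** Prefixes of a word applied to a point form a trajectory, so stability bounds all runs from a
    small ball; linearity in the starting point removes the restriction. *)
Lemma run_bounded {R : realType} {m n : nat} (A : 'I_m -> 'M[R]_n) :
  lyapunov_stable A ->
  exists2 C : R, 0 < C & forall w x, `|run A w x| <= C * `|x|.
Proof.
move=> /(_ 1 ltr01)[d d0 H].
(* The 1 serves the empty word, [d^-1] the rescaling of [x] to norm [d]. *)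
exists (Num.max 1 d^-1) => [|w x]; first by rewrite lt_max ltr01.
have [->|x0] := eqVneq x 0.
  have -> : run A w 0 = 0 :> 'cV[R]_n.
    by elim: w => //= i w IH; rewrite mulmx0.
  by rewrite normr0 mulr0.
have nx0 : 0 < `|x| by rewrite normr_gt0.
case: w => [|i0 w]; first by rewrite ler_peMl // le_max lexx.
set v := i0 :: w.
pose y := (d / `|x|) *: x.
have ny : `|y| <= d.
  by rewrite normrZ gtr0_norm ?divr_gt0 // divfK ?gt_eqF.
(* Past the end of [v], [nth] keeps choosing [i0], so the trajectory is infinite. *)
have ty : trajectory A (fun k => run A (mkseq (nth i0 v) k) y).
  by move=> k; rewrite mkseqS {2}/run foldl_rcons; apply: hull_vertex.
have := H _ ty ny (size v); rewrite mkseq_nth runZ normrZ.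
rewrite gtr0_norm ?divr_gt0 // mulrAC ler_pdivrMr // mul1r => le1.
apply: (@le_trans _ _ (d^-1 * `|x|)); first by rewrite ler_pdivlMl.
by rewrite ler_wpM2r // le_max lexx orbT.
Qed.

(* A point from which arbitrarily long runs stay larger than
   [eps] has a successor with the same property; iterating gives a trajectory
   that stays larger than [eps / C]. *)
Lemma run_small {R : realType} {m n : nat} (A : 'I_m -> 'M[R]_n) x (eps : R) :
  asymptotically_stable A -> 0 < eps ->
  exists N, forall w, (N <= size w)%N -> `|run A w x| <= eps.
Proof.
move=> [/run_bounded[C C0 HC] cvgA] eps0.
pose bad y := forall N, exists2 w, (N <= size w)%N & eps < `|run A w y|.
apply: contrapT => nex.
have badx : bad x.
  move=> N; apply: contrapT => nw; apply: nex; exists N => w Nw.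
  by rewrite leNgt; apply/negP => lt; apply: nw; exists w.
have step y : exists z, bad y -> bad z /\ exists i, z = A i *m y.
  have [by_|] := pselect (bad y); last by exists y.
  suff [i bi] : exists i, bad (A i *m y).
    by exists (A i *m y) => _; split=> //; exists i.
  apply: contrapT => ni.
  have /choice[N HN] : forall i, exists N, forall w, (N <= size w)%N ->
      `|run A w (A i *m y)| <= eps.
    move=> i; apply: contrapT => nN; apply: ni; exists i => N.
    apply: contrapT => nw; apply: nN; exists N => w Nw.
    by rewrite leNgt; apply/negP => lt; apply: nw; exists w.
  (* The [.+1] excludes the empty word and accounts for the first letter [i]. *)
  have [[|i w] //=] := by_ (\max_i N i).+1.
  rewrite ltnS => szw; rewrite ltNge HN //.
  exact: leq_trans (leq_bigmax i) szw.
have [f Hf] := choice step.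
have badk k : bad (iter k f x) by elim: k => // k /Hf[].
have traj : trajectory A (fun k => iter k f x).
  by move=> k; have [_ [i /= ->]] := Hf _ (badk k); apply: hull_vertex.
have /cvgrPdist_lt/(_ (eps / C) (divr_gt0 eps0 C0))[N _ /(_ N (leqnn N))] :=
  cvgA _ traj.
rewrite /= sub0r normrN ltNge ler_pdivrMr // => /negP; apply.
(* Some run from this point exceeds [eps], whereas [C] times the norm of the point bounds all its
   runs. *)
have [w _ lt] := badk N 0%N.
by rewrite mulrC; apply: le_trans (ltW lt) (HC w _).
Qed.

Lemma cV_norm_coef {R : realType} {n : nat} (x : 'cV[R]_n) j :
  `|x j ord0| <= `|x|.
Proof.
rewrite [leRHS]/Num.norm /= mx_normrE.
by apply/bigmax_geP; right => /=; exists (j, ord0).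
Qed.

(** The threshold of [run_small] depends on the point; by linearity the finitely many basis vectors
    suffice, and their thresholds have a maximum. *)
Lemma run_contracting {R : realType} {m n : nat} (A : 'I_m -> 'M[R]_n) :
  asymptotically_stable A ->
  exists N, forall w x, size w = N -> `|run A w x| <= 2^-1 * `|x|.
Proof.
(* The [n] coordinates contribute at most [n * eps <= 1/2]; [n.+1] keeps the denominator nonzero for
   [n = 0]. *)
move=> stA; pose eps : R := (2 * n.+1%:R)^-1.
have eps0 : 0 < eps by rewrite invr_gt0 mulr_gt0.
have /choice[N HN] := fun j : 'I_n =>
  run_small A (delta_mx j ord0) eps stA eps0.
exists (\max_j N j)%N => w x szw.
have xE : x = \sum_j x j ord0 *: delta_mx j ord0.
  by rewrite {1}(matrix_sum_delta x); apply: eq_bigr => j _; rewrite big_ord1.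
rewrite {1}xE run_sum.
apply: le_trans (ler_norm_sum _ _ _) _.
apply: (@le_trans _ _ (\sum_(j < n) `|x| * eps)).
  apply: ler_sum => j _; rewrite normrZ ler_pM //; first exact: cV_norm_coef.
  by apply: HN; rewrite szw; apply: leq_bigmax.
rewrite sumr_const card_ord -mulrnAr mulrC ler_wpM2r // -[eps *+ n]mulr_natr.
by rewrite /eps invfM -mulrA ler_piMr ?invr_ge0 // ler_pdivrMl // mulr1 ler_nat.
Qed.

(** Linear forms are row vectors: composing with a matrix is a product and adding two power sums is
    concatenation, so convexity and homogeneity need only one proof. *)
Definition power_sum {R : realType} {n : nat} (e : nat) (s : seq 'rV[R]_n)
    (x : 'cV[R]_n) : R :=
  \sum_(l <- s) ((l *m x) 0 0) ^+ e.

Definition power_sum_mpoly {R : realType} {n : nat} (e : nat)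
    (s : seq 'rV[R]_n) : mpoly.mpoly n R :=
  \sum_(l <- s) (\sum_j l 0 j *: mpoly.mpolyX R (mpoly.mnm1 j)) ^+ e.

Lemma power_sum_mpolyE {R : realType} {n : nat} e (s : seq 'rV[R]_n) x :
  mpoly_fun (power_sum_mpoly e s) x = power_sum e s x.
Proof.
rewrite /mpoly_fun /power_sum_mpoly /power_sum raddf_sum /=.
apply: eq_bigr => l _; rewrite rmorphXn /= raddf_sum /= mxE; congr (_ ^+ e).
by apply: eq_bigr => j _; rewrite mevalZ mevalXU.
Qed.

Lemma power_sum_mpoly_homogeneous {R : realType} {n : nat} e
    (s : seq 'rV[R]_n) :
  homogeneous (power_sum_mpoly e s).
Proof.
apply: (@homogE _ _ _ (1 * e)%N).
apply: rpred_sum => l _; apply: dhomogMn; apply: rpred_sum => j _.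
by apply: rpredZ; rewrite dhomogX /= mdeg1.
Qed.

Lemma exp_pow2_ge0 {R : realType} k (x : R) : 0 <= x ^+ (2 ^ k.+1).
Proof. by rewrite expnS exprM exprn_ge0 // sqr_ge0. Qed.

(** Exponents that are powers of two allow induction by squaring, which is convex, and monotone on
    nonnegative numbers. *)
Lemma exp_pow2_convex {R : realType} k (a b t : R) : 0 <= t <= 1 ->
  (t * a + (1 - t) * b) ^+ (2 ^ k.+1) <=
  t * a ^+ (2 ^ k.+1) + (1 - t) * b ^+ (2 ^ k.+1).
Proof.
move=> /andP[t0 t1].
have sq u v : (t * u + (1 - t) * v) ^+ 2 <= t * u ^+ 2 + (1 - t) * v ^+ 2.
  rewrite -subr_ge0 (_ : _ - _ = t * (1 - t) * (u - v) ^+ 2); last by ring.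
  by rewrite mulr_ge0 ?sqr_ge0 // mulr_ge0 // subr_ge0.
elim: k => [|k IH]; first by rewrite expn1.
rewrite expnSr !exprM; apply: le_trans (sq _ _).
by rewrite ler_pXn2r // nnegrE ?addr_ge0 ?mulr_ge0 ?subr_ge0 //;
  exact: exp_pow2_ge0.
Qed.

Lemma power_sum_mpoly_convex {R : realType} {n : nat} k (s : seq 'rV[R]_n) :
  convex_mpoly (power_sum_mpoly (2 ^ k.+1) s).
Proof.
move=> t x y _ _; rewrite !power_sum_mpolyE convRE /power_sum !mulr_sumr.
rewrite -big_split /=; apply: ler_sum => l _.
rewrite /conv /= mulmxDr -!scalemxAr !mxE.
by apply: exp_pow2_convex; rewrite ge0 le1.
Qed.

Lemma power_sum_ge0 {R : realType} {n : nat} k (s : seq 'rV[R]_n) x :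
  0 <= power_sum (2 ^ k.+1) s x.
Proof. by apply: sumr_ge0 => l _; apply: exp_pow2_ge0. Qed.

(** The operator [T] of the overview, acting on lists of linear forms. *)
Definition pullback {R : realType} {m n : nat} (A : 'I_m -> 'M[R]_n)
    (s : seq 'rV[R]_n) : seq 'rV[R]_n :=
  [seq l *m A i | i <- enum 'I_m, l <- s].

Lemma power_sum_pullback {R : realType} {m n : nat} (A : 'I_m -> 'M[R]_n)
    e s x :
  power_sum e (pullback A s) x = \sum_i power_sum e s (A i *m x).
Proof.
rewrite /power_sum /pullback big_allpairs_dep /= big_enum /=.
by apply: eq_bigr => i _; apply: eq_bigr => l _; rewrite mulmxA.
Qed.

Definition pullbacks {R : realType} {m n : nat} (A : 'I_m -> 'M[R]_n) N
    (s : seq 'rV[R]_n) : seq 'rV[R]_n :=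
  flatten [seq iter k (pullback A) s | k <- iota 0 N].

Lemma power_sum_pullbacks {R : realType} {m n : nat} (A : 'I_m -> 'M[R]_n)
    e N s x :
  power_sum e (pullbacks A N s) x =
  \sum_(0 <= k < N) power_sum e (iter k (pullback A) s) x.
Proof. by rewrite /power_sum big_flatten big_map /index_iota subn0. Qed.

(** Both sides are the sum of [T^k q] over [k <= N], with the term [k = 0] split off on the left and
    [k = N] on the right. *)
Lemma power_sum_pullbacks_telescope {R : realType} {m n : nat}
    (A : 'I_m -> 'M[R]_n) e N s x :
  power_sum e s x + \sum_i power_sum e (pullbacks A N s) (A i *m x) =
  power_sum e (pullbacks A N s) x + power_sum e (iter N (pullback A) s) x.
Proof.
under eq_bigr do rewrite power_sum_pullbacks.
rewrite power_sum_pullbacks exchange_big /= -big_nat_recr //=.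
rewrite big_nat_recl //=; congr (_ + _); apply: eq_bigr => k _.
by rewrite power_sum_pullback.
Qed.

(** Unfolding [T^N] gives one term for each of the [m ^ N] words of length [N]. *)
Lemma power_sum_iter_pullback_le {R : realType} {m n : nat}
    (A : 'I_m -> 'M[R]_n) e N s x B :
  (forall w, size w = N -> power_sum e s (run A w x) <= B) ->
  power_sum e (iter N (pullback A) s) x <= (m ^ N)%:R * B.
Proof.
elim: N x => [|N IH] x H; first by rewrite mul1r; apply: (H [::]).
rewrite iterS power_sum_pullback expnS natrM -mulrA mulr_natl.
rewrite -[X in _ *+ X](card_ord m) -sumr_const; apply: ler_sum => i _.
by apply: IH => w sw; apply: (H (i :: w)); rewrite /= sw.
Qed.

Definition coordinates (R : realType) (n : nat) : seq 'rV[R]_n :=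
  [seq delta_mx 0 j | j <- enum 'I_n].

Lemma power_sum_coordinates {R : realType} {n : nat} e (x : 'cV[R]_n) :
  power_sum e (coordinates R n) x = \sum_j x j 0 ^+ e.
Proof.
rewrite /power_sum big_map big_enum; apply: eq_bigr => j _.
by rewrite -rowE mxE.
Qed.

Lemma power_sum_coordinates_ge {R : realType} {n : nat} k (x : 'cV[R]_n) :
  `|x| ^+ (2 ^ k.+1) <= power_sum (2 ^ k.+1) (coordinates R n) x.
Proof.
have [->|x0] := eqVneq x 0.
  by rewrite normr0 expr0n expn_eq0 /= power_sum_ge0.
(* The sup norm is attained at a coordinate [i]; the other even powers are nonnegative. *)
have /mx_norm_neq0[[i j] /= xE] : mx_norm x != 0.
  by apply/eqP => /mx_norm_eq0/eqP; apply/negP.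
rewrite power_sum_coordinates (bigD1 i) //= [`|x|]xE (ord1 j).
rewrite -normrX ger0_norm ?exp_pow2_ge0 //.
by rewrite lerDl; apply: sumr_ge0 => ? _; apply: exp_pow2_ge0.
Qed.

Lemma power_sum_coordinates_le {R : realType} {n : nat} k (x : 'cV[R]_n) :
  power_sum (2 ^ k.+1) (coordinates R n) x <= n%:R * `|x| ^+ (2 ^ k.+1).
Proof.
rewrite power_sum_coordinates mulr_natl -[X in _ *+ X](card_ord n) -sumr_const.
apply: ler_sum => i _; apply: le_trans (ler_norm _) _; rewrite normrX.
by rewrite ler_pXn2r ?nnegrE ?expn_gt0 ?cV_norm_coef.
Qed.

Theorem theorem3p2 (R : realType) (m n : nat) (A : 'I_m -> 'M[R]_n) :
  asymptotically_stable A ->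
  exists p : mpoly.mpoly n R,
    [/\ convex_mpoly p, positive_definite p, homogeneous p &
        forall (x : 'cV[R]_n) (i : 'I_m), x != 0 ->
          mpoly_fun p (A i *m x) < mpoly_fun p x].
Proof.
move=> /run_contracting[N HN].
(* [K] counts words times coordinates; [K < e] yields [K < 2 ^ e], so the factor [2^-e] outweighs
   [K]. *)
pose K := (m ^ N * n)%N; pose e := (2 ^ K.+1)%N.
pose s := coordinates R n.
have s_gt0 x : x != 0 -> 0 < power_sum e s x.
  move=> x0; apply: lt_le_trans (power_sum_coordinates_ge K x).
  by rewrite exprn_gt0 // normr_gt0.
have last_lt x : x != 0 ->
    power_sum e (iter N (pullback A) s) x < power_sum e s x.
  move=> x0.
  apply: (@le_lt_trans _ _ (K%:R * 2^-1 ^+ e * power_sum e s x)); last first.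
    rewrite gtr_pMl ?s_gt0 // exprVn ltr_pdivrMr ?exprn_gt0 // mul1r -natrX.
    rewrite ltr_nat (ltn_trans (ltn_expl K (leqnn 2))) // ltn_exp2l //.
    exact: ltn_trans (ltn_expl K.+1 (leqnn 2)).
  rewrite /K natrM -!mulrA; apply: power_sum_iter_pullback_le => w /HN wx.
  apply: le_trans (power_sum_coordinates_le K _) _.
  rewrite ler_wpM2l //.
  apply: (@le_trans _ _ ((2^-1 * `|x|) ^+ e)).
    by rewrite ler_pXn2r ?nnegrE ?expn_gt0 ?mulr_ge0.
  rewrite exprMn ler_wpM2l ?exprn_ge0 //; exact: power_sum_coordinates_ge.
have successors_lt x : x != 0 ->
    \sum_i power_sum e (pullbacks A N s) (A i *m x) <
    power_sum e (pullbacks A N s) x.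
  move=> x0; have := power_sum_pullbacks_telescope A e N s x.
  by have := last_lt _ x0; lra.
have ge0 x : 0 <= \sum_i power_sum e (pullbacks A N s) (A i *m x).
  by apply: sumr_ge0 => i _; apply: power_sum_ge0.
exists (power_sum_mpoly e (pullbacks A N s)); split.
- exact: power_sum_mpoly_convex.
(* Positivity follows from the decrease: [p x] exceeds a sum of nonnegative values. *)
- by move=> x /successors_lt; rewrite power_sum_mpolyE; apply: le_lt_trans.
- exact: power_sum_mpoly_homogeneous.
- move=> x i /successors_lt; rewrite !power_sum_mpolyE; apply: le_lt_trans.
  rewrite (bigD1 i) //= lerDl; apply: sumr_ge0 => j _; exact: power_sum_ge0.
Qed.
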